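(* Let $k$ be a field of characteristic $p>0$ and let $A$ be the Hopf algebra of third type over $k$ with $G=\langle a\rangle$ cyclic of $p$-power order and $\alpha=0$. Then $A$ is indecomposable as an algebra and its simple modules are one-dimensional. There are $p$ simple modules $T_c$, indexed by $c\in\mathbb{F}_p$, on which $x$ acts by scalar multiplication with $c$ and $a$ acts as the identity. The projective indecomposable modules of $A$ are the modules $Ae_c$, $c\in\mathbb{F}_p$.
   Context: Explicitly, $A$ is the $k$-algebra generated by $a,x$ with basis $(a^jx^i)_{0\le j<p^r,\ 0\le i\le p-1}$, where $p^r$ ($r\ge1$) is the order of $a$, and relations $a^{p^r}=1$, $axa^{-1}=x+(a-1)$, $x^p=x$; its Hopf structure is $\Delta(a)=a\otimes a$, $\Delta(x)=x\otimes a+1\otimes x$, $\epsilon(a)=1$, $\epsilon(x)=0$, $S(a)=a^{-1}$, $S(x)=-xa^{-1}$. For $c\in\mathbb{F}_p\subset k$, $e_c$ denotes the primitive idempotent of the subalgebra $k[x]/\langle x^p-x\rangle\subset A$ with $xe_c=ce_c$; these are orthogonal with sum $1$, and $k[x]/\langle x^p-x\rangle=\bigoplus_{c\in\mathbb{F}_p}k e_c$. *)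

(* Defs.v *)
From HB Require Import structures.
From mathcomp Require Import all_boot all_algebra all_field.

Set Implicit Arguments.
Unset Strict Implicit.
Unset Printing Implicit Defensive.

Import GRing.Theory.
Local Open Scope ring_scope.

(* U \otimes V is modelled by matrices: in the coordinates given by the chosen
   bases of U and V, the pure tensor of u and v is the rank-one matrix u^T v. *)
Section Tensor.
Variables (k : fieldType) (U V : vectType k).

Definition tensor : vectType k := 'M[k]_(\dim {:U}, \dim {:V}).

Definition tens (u : U) (v : V) : tensor :=
  \matrix_(i, j) (coord (vbasis fullv) i u * coord (vbasis fullv) j v).

(* The linear map U \otimes V -> W induced by a bilinear f : U -> V -> W. *)
Definition tlift (W : lmodType k) (f : U -> V -> W) (t : tensor) : W :=
  \sum_i \sum_j (t : 'M[k]_(\dim {:U}, \dim {:V})) i j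
     *: f (vbasis {:U})`_i (vbasis {:V})`_j.

Lemma tlift_tens (W : lmodType k) (f : U -> V -> W) :
    (forall v, linear (f^~ v)) -> (forall u, linear (f u)) ->
  forall u v, tlift f (tens u v) = f u v.
Proof.
move=> fl fr u v.
pose gl w : {linear U -> W} :=
  HB.pack (f^~ w) (GRing.isLinear.Build k U W _ _ (fl w)).
pose gr w : {linear V -> W} :=
  HB.pack (f w) (GRing.isLinear.Build k V W _ _ (fr w)).
rewrite [in RHS](coord_vbasis (memvf u)) -[RHS]/(gl v _) linear_sum.
apply: eq_bigr => i _; rewrite linearZ /=.
rewrite [in RHS](coord_vbasis (memvf v)) -[f _ _ in RHS]/(gr _ _) linear_sum.
rewrite scaler_sumr; apply: eq_bigr => j _.
by rewrite linearZ scalerA mxE.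
Qed.

End Tensor.

Section Hopf.
Variables (k : fieldType) (A : falgType k).

Definition tmul (s t : tensor A A) : tensor A A :=
  tlift (fun u v => tlift (fun u' v' => tens (u * u') (v * v')) t) s.

Record is_hopf_algebra (Delta : {linear A -> tensor A A})
    (eps : {lrmorphism A -> k^o}) (S : {linear A -> A}) : Prop := IsHopfAlgebra {
  comul1 : Delta 1 = tens 1 1;
  comulM : forall h g, Delta (h * g) = tmul (Delta h) (Delta g);
  (* both sides are read in A \otimes (A \otimes A) *)
  coassoc : forall h,
    tlift (fun u v => tlift (fun u1 u2 => tens u1 (tens u2 v)) (Delta u))
      (Delta h)
    = tlift (fun u v => tens u (Delta v)) (Delta h);
  counitl : forall h, tlift (fun u v => (eps u : k) *: v) (Delta h) = h;
  counitr : forall h, tlift (fun u v => (eps v : k) *: u) (Delta h) = h;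
  antipodel : forall h,
    tlift (fun u v => S u * v) (Delta h) = (eps h : k) *: (1 : A);
  antipoder : forall h,
    tlift (fun u v => u * S v) (Delta h) = (eps h : k) *: (1 : A)
}.

(* The Hopf algebra of third type with G = <a> cyclic of order p ^ r and
   alpha = 0. *)
Record third_type_cyclic (p r : nat) (a x : A)
    (Delta : {linear A -> tensor A A})
    (eps : {lrmorphism A -> k^o}) (S : {linear A -> A}) : Prop :=
  ThirdTypeCyclic {
  tt_basis : basis_of fullv
    [seq a ^+ j * x ^+ i | j <- iota 0 (p ^ r)%N, i <- iota 0 p];
  tt_order : a ^+ (p ^ r)%N = 1;
  tt_conj : a * x * a^-1 = x + (a - 1);
  tt_xp : x ^+ p = x;
  tt_hopf : is_hopf_algebra Delta eps S;
  tt_comul_a : Delta a = tens a a;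
  tt_comul_x : Delta x = tens x a + tens 1 x;
  tt_counit_a : eps a = 1;
  tt_counit_x : eps x = 0;
  tt_antipode_a : S a = a^-1;
  tt_antipode_x : S x = - (x * a^-1)
}.

(* The inclusion of F_p in k, for k of characteristic p. *)
Definition Fp_in (p : nat) (c : 'F_p) : k := (c : nat)%:R.

Definition primitive_idempotent (B : {vspace A}) (e : A) : Prop :=
  [/\ e \in B, e * e = e, e != 0
    & forall f g : A, f \in B -> g \in B -> f * f = f -> g * g = g ->
        f * g = 0 -> g * f = 0 -> e = f + g -> f = 0 \/ g = 0].

(* <<1; x>> is the subalgebra generated by x. *)
Definition eigen_idempotent (p : nat) (x : A) (c : 'F_p) (e : A) : Prop :=
  primitive_idempotent <<1; x>>%VS e /\ x * e = Fp_in c *: e.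

(* Objects of algType are nonzero by definition. *)
Definition indecomposable_algebra : Prop :=
  ~ exists (B C : algType k) (f : {lrmorphism A -> (B * C)%type}), bijective f.

(* k acts on an A-module through its image in A. *)
Definition one_dimensional (M : lmodType A) : Prop :=
  exists2 m0 : M, m0 != 0 & forall m : M, exists c : k, m = c%:A *: m0.

End Hopf.

Section Modules.
Variable A : nzRingType.

Definition module_iso (M N : lmodType A) : Prop :=
  exists f : {linear M -> N}, bijective f.

Definition simple_module (M : lmodType A) : Prop :=
  (exists m : M, m != 0) /\
  forall N : {pred M}, submod_closed N ->
    (forall m, m \in N -> m = 0) \/ (forall m, m \in N).

Definition indecomposable_module (M : lmodType A) : Prop :=
  (exists m : M, m != 0) /\
  forall N1 N2 : {pred M}, submod_closed N1 -> submod_closed N2 ->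
    (forall m, m \in N1 -> m \in N2 -> m = 0) ->
    (forall m, exists m1 m2, [/\ m1 \in N1, m2 \in N2 & m = m1 + m2]) ->
    (forall m, m \in N1 -> m = 0) \/ (forall m, m \in N2 -> m = 0).

Definition projective_module (P : lmodType A) : Prop :=
  forall (M N : lmodType A) (g : {linear M -> N}) (f : {linear P -> N}),
    (forall n, exists m, g m = n) ->
    exists h : {linear P -> M}, forall u, g (h u) = f u.

End Modules.

(* The left ideal A e as a left A-module. *)
Section LeftIdeal.
Variables (k : fieldType) (A : falgType k) (e : A).

Definition left_ideal_pred : {pred A^o} :=
  fun b => (b : A) \in limg (amulr e).

Lemma left_ideal_predP (b : A) :
  reflect (exists b' : A, b = b' * e) (b \in left_ideal_pred).
Proof.
apply: (iffP memv_imgP) => [[b' _ ->]|[b' ->]]; exists b';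
  by rewrite ?memvf // lfunE.
Qed.

Fact left_ideal_submod : submod_closed left_ideal_pred.
Proof.
split=> [|b _ _ /left_ideal_predP[u ->] /left_ideal_predP[v ->]].
  by apply/left_ideal_predP; exists 0; rewrite mul0r.
by apply/left_ideal_predP; exists (b * u + v); rewrite mulrDl -mulrA.
Qed.

HB.instance Definition _ :=
  GRing.isSubmodClosed.Build A A^o left_ideal_pred left_ideal_submod.

Record left_ideal : predArgType :=
  LeftIdeal { lival :> A^o; _ : lival \in left_ideal_pred }.

HB.instance Definition _ := [isSub for lival].
HB.instance Definition _ := [Choice of left_ideal by <:].
HB.instance Definition _ := [SubChoice_isSubLmodule of left_ideal by <:].

End LeftIdeal.

(* Main.v *)
Require Import Defs.
From HB Require Import structures.
From mathcomp Require Import all_boot all_algebra all_field.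
From mathcomp Require Import boolp.
From mathcomp Require Import freeg.
Import GRing.Theory.
Local Open Scope ring_scope.

(** The element g = a - 1 satisfies g ^+ (p ^ r) = 0, since a ^+ (p ^ r) = 1 in
characteristic p, and the defining relation becomes
x g = g x - g - g ^+ 2. By induction
x g^j = g^j (x - j) - j g^(j+1), and for j = n := p ^ r - 1, where p ^ r = 0 in
the field and g^(n+1) = 0, this reads x g^n = g^n (x + 1).

The idempotents e_c are Lagrange polynomials in x, so they are orthogonal with
sum 1, and since a is a polynomial in g, every element of A is a sum of terms
P(g) e_c. The p ^ r * p elements g^j e_c therefore span A, and A has that
dimension, so they form a basis ([gX_eigen_idempotent_basis]). Hence A e_c is a
uniserial k[g]-module, namely k[g]/(g^(n+1)): every nonzero submodule contains
the socle vector g^n e_c ([soc_essential]), and an element not killed by g^n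
generates A e_c ([eigen_ideal_generator]). The vector g^n e_c is killed by g
and is an eigenvector of x for the eigenvalue c + 1. The rest follows from this.

- The line k g^n e_(c-1) is a left ideal, and it is the module T_c. Conversely,
  a simple module contains a vector killed by g that is an eigenvector of x: the
  last nonzero one among the g^j e_c m, for m with e_c m <> 0. Such a vector
  spans a submodule.

- A e_c is a direct summand of A, so it is projective. Two nonzero submodules
  of it share the socle, so it is indecomposable, and the socle determines c.

- A central idempotent z acts on each A e_c as 0 or 1, because the socle is
  essential. As e_(c+1) fixes the socle of A e_c, the two actions on A e_c and
  on A e_(c+1) agree ([central_idempotent_trivial]). The index c runs through
  the cyclic group F_p, so z = 0 or z = 1, and A is indecomposable.

- Let P be an indecomposable projective module. If g^n phi(m) were 0 for all
  linear forms phi and all m in P, then all phi(m) would lie in g A, and a dual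
  basis would give P = g P, so P = 0 by nilpotency. Thus some phi(m) e_c
  generates A e_c; the map y |-> phi(y) e_c from P onto A e_c splits, and it is
  an isomorphism because P is indecomposable
  ([projective_indecomposable_iso]). *)

(** * Modules over a ring *)

Section ModuleTheory.
Set Implicit Arguments.
Unset Strict Implicit.
Variable A : nzRingType.

Lemma linear_of_fun (M N : lmodType A) (f : M -> N) :
  linear f -> exists g : {linear M -> N}, g =1 f.
Proof.
move=> fl.
pose g : {linear M -> N} := HB.pack f (GRing.isLinear.Build A M N _ _ fl).
by exists g.
Qed.

Lemma module_iso_sym (M N : lmodType A) : module_iso M N -> module_iso N M.
Proof.
case=> f [f' fK f'K]; have [g gE] := linear_of_fun (can2_linear fK f'K).
by exists g; exists f => u; rewrite gE.
Qed.

Lemma module_iso_of_surjection (M N : lmodType A) (f : {linear M -> N}) :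
  (forall u, f u = 0 -> u = 0) -> (forall v, exists u, f u = v) ->
  module_iso M N.
Proof.
move=> f_inj f_surj; exists f.
have f_ex v : exists u, f u == v by have [u <-] := f_surj v; exists u.
have fK v : f (xchoose (f_ex v)) = v by apply/eqP; apply: (xchooseP (f_ex v)).
exists (fun v => xchoose (f_ex v)) => // u.
by apply/eqP; rewrite -subr_eq0; apply/eqP/f_inj; rewrite raddfB /= fK subrr.
Qed.

(** The cyclic submodule generated by m0 has no decision procedure, so its
    boolean characteristic function is obtained classically. *)
Lemma simple_module_cyclic (M : lmodType A) (m0 : M) :
  simple_module M -> m0 != 0 -> forall m, exists b, m = b *: m0.
Proof.
case=> _ M_simple m0_neq0 m.
pose N : {pred M} := fun m => `[< exists b, m = b *: m0 >].
have NE u : reflect (exists b, u = b *: m0) (u \in N) by apply: asboolP.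
have N_sub : submod_closed N.
  split=> [|b _ _ /NE[c ->] /NE[d ->]]; apply/NE.
    by exists 0; rewrite scale0r.
  by exists (b * c + d); rewrite scalerDl scalerA.
have [N0|/(_ m)/NE//] := M_simple N N_sub.
by case/eqP: m0_neq0; apply: N0; apply/NE; exists 1; rewrite scale1r.
Qed.

(** The idempotent s \o f splits P into its fixed points, which are the image of
    s, and the kernel of f; the first summand is nonzero, so the kernel is 0. *)
Lemma indecomposable_retract (P Q : lmodType A) (f : {linear P -> Q})
    (s : {linear Q -> P}) :
  indecomposable_module P -> (exists q : Q, q != 0) -> cancel s f ->
  module_iso P Q.
Proof.
move=> [_ P_indec] [q q_neq0] sK.
pose N1 : {pred P} := fun y => s (f y) == y.
pose N2 : {pred P} := fun y => f y == 0.
have N1P y : reflect (s (f y) = y) (y \in N1) by apply: eqP.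
have N2P y : reflect (f y = 0) (y \in N2) by apply: eqP.
have f_inj u : f u = 0 -> u = 0.
  move: u; have [] := P_indec N1 N2.
  - split=> [|b u v /N1P uE /N1P vE]; apply/N1P; first by rewrite !raddf0.
    by rewrite !linearP uE vE.
  - split=> [|b u v /N2P uE /N2P vE]; apply/N2P; first by rewrite !raddf0.
    by rewrite linearP uE vE scaler0 add0r.
  - by move=> m /N1P mE /N2P m0; rewrite -mE m0 raddf0.
  - move=> m; exists (s (f m)), (m - s (f m)).
    split; last by rewrite addrC subrK.
      by apply/N1P; rewrite sK.
    by apply/N2P; rewrite raddfB /= sK subrr.
  - move=> N1_0; case/eqP: q_neq0.
    have /(congr1 f) : s q = 0 by apply: N1_0; apply/N1P; rewrite sK.
    by rewrite sK raddf0.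
  - by move=> N2_0 u fu0; apply/N2_0/N2P.
by apply: (module_iso_of_surjection f_inj) => v; exists (s v).
Qed.

Lemma fglift_linear (M : lmodType A) (K : choiceType) (h : K -> M) :
  linear (fglift h : {freeg K / A} -> M).
Proof.
pose L : {additive {freeg K / A} -> M} :=
  HB.pack (fglift h : {freeg K / A} -> M)
    (GRing.isAdditive.Build _ _ _ (lift_is_additive h)).
have LU c z : L << c *g z >> = c *: h z by apply: liftU.
have LE D : L D = \sum_(z <- dom D) coeff z D *: h z.
  by rewrite -{1}(freeg_sumE D) raddf_sum; apply: eq_bigr => z _; rewrite LU.
move=> c D1 D2; rewrite -[LHS]/(L _) raddfD; congr (_ + _).
rewrite -[fglift h D1]/(L D1) [c *: D1]/(fgscale c D1) /fgscale raddf_sum LE.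
by rewrite scaler_sumr; apply: eq_bigr => z _; rewrite LU scalerA.
Qed.

Lemma coeff_linear (K : choiceType) (z : K) :
  linear (coeff z : {freeg K / A} -> A^o).
Proof. by move=> c D1 D2; rewrite coeffD coeffZ. Qed.

(** A section of the canonical surjection onto P from the free module on the set
    P has these linear forms as its coordinates. *)
Lemma projective_dual_basis (P : lmodType A) : projective_module P ->
  forall m : P, exists (I : Type) (d : seq I) (phi : I -> {linear P -> A^o})
    (n : I -> P), m = \sum_(i <- d) (phi i m : A) *: n i.
Proof.
move=> P_proj m.
have [pi piE] := linear_of_fun (fglift_linear (fun n : P => n)).
have piU c z : pi << c *g z >> = c *: z by apply: etrans (piE _) (liftU _ _ _).
have [|s sK] := P_proj _ _ pi idfun.
  by move=> n; exists << n >>; rewrite piU scale1r.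
pose coord z : {linear {freeg P / A} -> A^o} :=
  HB.pack (coeff z : {freeg P / A} -> A^o)
    (GRing.isLinear.Build A {freeg P / A} A^o _ _ (coeff_linear z)).
pose phi z : {linear P -> A^o} := coord z \o s.
exists P, (dom (s m)), phi, id.
rewrite -[m in LHS](sK m) -{1}(freeg_sumE (s m)) raddf_sum.
by apply: eq_bigr => z _; apply: piU.
Qed.

End ModuleTheory.

(** * Principal left ideals *)

Section LeftIdeal.
Set Implicit Arguments.
Unset Strict Implicit.
Variables (k : fieldType) (A : falgType k).

Definition left_mult (e b : A) : left_ideal e :=
  LeftIdeal (introT (left_ideal_predP e (b * e)) (ex_intro _ b erefl)).

Lemma left_idealP (e : A) (u : left_ideal e) : exists b, u = left_mult e b.
Proof.
case: u => y yP; have [b yE] := elimT (left_ideal_predP _ _) yP.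
by exists b; apply: val_inj.
Qed.

Lemma left_multE (e b : A) : left_mult e b = b *: left_mult e 1.
Proof. by apply: val_inj; rewrite /= mul1r. Qed.

(** This is A e = A / ann(e): a map out of A e is a vector annihilated by
    ann(e). *)
Lemma left_ideal_hom (e : A) (M : lmodType A) (m : M) :
  (forall b : A, b * e = 0 -> b *: m = 0) ->
  exists f : {linear left_ideal e -> M}, forall b, f (left_mult e b) = b *: m.
Proof.
move=> ann.
(* a linear choice of b with u = b e; by ann the choice does not matter *)
pose f (u : left_ideal e) : M := ((amulr e)^-1%VF (lival u) : A) *: m.
have fE b (u : left_ideal e) : lival u = b * e -> f u = b *: m.
  move=> uE; apply/eqP; rewrite -subr_eq0 -scalerBl; apply/eqP/ann.
  have amulrE y : y * e = amulr e y by rewrite lfunE.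
  by rewrite mulrBl -uE amulrE limg_lfunVK ?subrr //; case: (u).
have [|g gE] := @linear_of_fun _ _ _ f; last first.
  by exists g => b; rewrite gE; apply: (fE _ (left_mult e b)).
move=> c u v; have [b ->] := left_idealP u; have [d ->] := left_idealP v.
rewrite !(fE _ (left_mult e _) erefl) scalerA -scalerDl; apply: fE.
by rewrite /= mulrDl -mulrA.
Qed.

Lemma left_ideal_projective (e : A) :
  e * e = e -> projective_module (left_ideal e : lmodType A).
Proof.
move=> e_idem M N g f g_surj.
have [m gm] := g_surj (f (left_mult e 1)).
have [|h hE] := @left_ideal_hom e M (e *: m).
  by move=> b be0; rewrite scalerA be0 scale0r.
exists h => u; have [b ->] := left_idealP u.
rewrite hE !linearZ /= gm -!linearZ; congr (f _); apply: val_inj => /=.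
by rewrite -[LHS]/(b * (e * (1 * e))) mul1r e_idem.
Qed.

End LeftIdeal.

(** * Polynomials acting on eigenvectors *)

Section Algebra.
Set Implicit Arguments.
Unset Strict Implicit.

Lemma horner_alg_eigen (k : fieldType) (A : algType k) (M : lmodType A) (y : A)
    (v : M) (c : k) (q : {poly k}) :
  y *: v = c%:A *: v -> horner_alg y q *: v = q.[c]%:A *: v.
Proof.
move=> yv; have /factor_theorem[s sE] : root (q - q.[c]%:P) c.
  by rewrite rootE !hornerE subrr.
rewrite -[in LHS](subrK q.[c]%:P q) sE rmorphD rmorphM rmorphB /=.
rewrite horner_algX !horner_algC scalerDl -scalerA scalerBl yv subrr.
by rewrite scaler0 add0r.
Qed.

Lemma span_ind (k : fieldType) (V : vectType k) (s : seq V) (P : V -> Prop) :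
  (forall c u v, P u -> P v -> P (c *: u + v)) -> P 0 ->
  (forall v, v \in s -> P v) -> forall v, v \in <<s>>%VS -> P v.
Proof.
move=> PD P0 Ps v vs; rewrite (@coord_span _ _ _ (in_tuple s) v vs).
elim/big_rec: _ => // i u _; apply: PD.
by apply: Ps; rewrite mem_nth.
Qed.

End Algebra.

(** * Idempotent polynomials over the prime field *)

Section PrimeField.
Set Implicit Arguments.
Unset Strict Implicit.
Variables (k : fieldType) (p : nat).
Hypothesis charkp : p \in [pchar k].

Let p_prime : prime p := pcharf_prime charkp.

Lemma Fp_inD (c d : 'F_p) : Fp_in k (c + d) = Fp_in k c + Fp_in k d.
Proof.
rewrite /Fp_in -natrD -(GRing.natr_mod_pchar charkp (c + d)%N) /=.
by rewrite [in X in (_ %% X)%N]Fp_cast.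
Qed.

Lemma Fp_in1 : Fp_in k (1 : 'F_p) = 1.
Proof. by rewrite /Fp_in /= Fp_cast // modn_small ?prime_gt1. Qed.

Lemma Fp_in_nat j : Fp_in k (j%:R : 'F_p) = j%:R.
Proof.
elim: j => [|j IHj]; first by rewrite /Fp_in.
by rewrite -addn1 !natrD Fp_inD IHj Fp_in1.
Qed.

Lemma Fp_inN (c : 'F_p) : Fp_in k (- c) = - Fp_in k c.
Proof. by apply/eqP; rewrite -addr_eq0 -Fp_inD addNr /Fp_in. Qed.

Lemma Fp_in_inj : injective (@Fp_in k p).
Proof.
move=> c d /eqP; rewrite -subr_eq0 -Fp_inN -Fp_inD -(dvdn_pcharf charkp).
move: (c - d) (subr_eq0 c d) => b b0 p_b; apply/eqP; rewrite -b0.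
have lt_bp : (b < p)%N by rewrite -[X in (_ < X)%N]Fp_cast.
case: (posnP b) => [b_eq0|b_gt0]; first by apply/eqP; apply: ord_inj.
by have := dvdn_leq b_gt0 p_b; rewrite leqNgt lt_bp.
Qed.

Lemma Fp_in_Frobenius (c : 'F_p) : Fp_in k c ^+ p = Fp_in k c.
Proof. exact: pFrobenius_aut_nat charkp c. Qed.

(** The Lagrange interpolation polynomial at c for the p points of F_p, as
    Fermat's little theorem makes (d - c)^(p-1) the indicator of d <> c. *)
Definition idempotent_poly (c : 'F_p) : {poly k} :=
  1 - ('X - (Fp_in k c)%:P) ^+ p.-1.

Lemma idempotent_poly_eval (c d : 'F_p) :
  (idempotent_poly c).[Fp_in k d] = (d == c)%:R.
Proof.
rewrite /idempotent_poly !hornerE; have [->|neq_dc] := eqVneq.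
  by rewrite subrr expr0n -(subnKC (prime_gt1 p_prime)) subr0.
have dc_neq0 : Fp_in k d - Fp_in k c != 0.
  by rewrite subr_eq0 (inj_eq Fp_in_inj).
suff -> : (Fp_in k d - Fp_in k c) ^+ p.-1 = 1 by rewrite subrr.
apply: (mulfI dc_neq0); rewrite mulr1 -exprS prednK ?prime_gt0 //.
by rewrite -Fp_inN -Fp_inD Fp_in_Frobenius.
Qed.

(** The difference of the two sides has size at most p and vanishes at the p
    points of F_p. *)
Lemma sum_idempotent_poly : \sum_(c : 'F_p) idempotent_poly c = 1.
Proof.
apply/eqP; rewrite -subr_eq0.
apply: contraT => /(max_poly_roots (rs := [seq Fp_in k d | d <- enum 'F_p])).
rewrite size_map -cardE card_Fp // map_inj_uniq ?enum_uniq //; last first.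
  exact: Fp_in_inj.
have -> : all (root (\sum_c idempotent_poly c - 1))
              [seq Fp_in k d | d <- enum 'F_p].
  apply/allP=> _ /mapP[d _ ->]; rewrite rootE !hornerE horner_sum (bigD1 d) //=.
  rewrite idempotent_poly_eval eqxx big1 ?addr0 ?subrr // => c neq_cd.
  by rewrite idempotent_poly_eval eq_sym (negPf neq_cd).
move=> /(_ isT isT); rewrite ltnNge => /negP[].
have sz c : (size (idempotent_poly c) <= p)%N.
  rewrite (leq_trans (size_polyD _ _)) // size_polyN size_poly1 geq_max.
  by rewrite size_exp_XsubC prednK ?prime_gt0 // leqnn.
rewrite (leq_trans (size_polyD _ _)) // size_polyN size_poly1 geq_max.
rewrite prime_gt0 // andbT (leq_trans (size_sum _ _ _)) //.
by apply/bigmax_leqP => c _.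
Qed.

End PrimeField.

(** * The basis g^j e_c *)

Section Structure.
Set Implicit Arguments.
Unset Strict Implicit.
Variables (k : fieldType) (p : nat) (r : nat).
Hypotheses (charkp : p \in [pchar k]) (r_gt0 : (0 < r)%N).
Variables (A : falgType k) (a x : A) (e : 'F_p -> A).
Implicit Types (c d : 'F_p) (b : A) (P Q : {poly k}).
Hypothesis a_x_basis : basis_of fullv
  [seq a ^+ j * x ^+ i | j <- iota 0 (p ^ r)%N, i <- iota 0 p].
Hypothesis aN : a ^+ (p ^ r)%N = 1.
Hypothesis conj_x : a * x * a^-1 = x + (a - 1).
Hypothesis xp : x ^+ p = x.
Hypothesis eE : forall c : 'F_p, eigen_idempotent x c (e c).

Let p_prime : prime p := pcharf_prime charkp.
Let charAp : p \in [pchar A].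
Proof. by rewrite pchar_lalg. Qed.

(* g is a variable and not a definition, so that rewriting does not unfold it *)
Variable g : A.
Hypothesis gE : g = a - 1.
Let n := (p ^ r).-1.

Let nS : n.+1 = (p ^ r)%N.
Proof. by rewrite prednK // expn_gt0 prime_gt0. Qed.

Let idem (c : 'F_p) := horner_alg x (idempotent_poly k c).

Let x_idem c : x * idem c = Fp_in k c *: idem c.
Proof.
apply/eqP; rewrite -subr_eq0 -mulr_algl -mulrBl; apply/eqP.
have -> : x - (Fp_in k c)%:A = horner_alg x ('X - (Fp_in k c)%:P).
  by rewrite rmorphB /= horner_algX horner_algC.
rewrite -rmorphM mulrBr mulr1 -exprS prednK ?prime_gt0 // rmorphB rmorphXn.
rewrite rmorphB /= horner_algX horner_algC.
rewrite -(pFrobenius_autE charAp) pFrobenius_autB_comm; last first.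
  by rewrite /GRing.comm mulr_algl mulr_algr.
rewrite !pFrobenius_autE xp exprZn expr1n Fp_in_Frobenius //.
by rewrite subrr.
Qed.

Lemma eigenvector_idem (M : lmodType A) (v : M) c d :
  x *: v = (Fp_in k c)%:A *: v -> idem d *: v = v *+ (c == d).
Proof.
move=> xv; rewrite (horner_alg_eigen _ xv) idempotent_poly_eval //.
by case: eqP; rewrite ?scale1r ?scale0r.
Qed.

Let idemM c d : idem c * idem d = idem d *+ (c == d).
Proof.
have xd : x *: (idem d : A^o) = (Fp_in k d)%:A *: (idem d : A^o).
  by rewrite /GRing.scale /= mulr_algl x_idem.
by rewrite eq_sym; apply: (eigenvector_idem c xd).
Qed.

Let sum_idem : \sum_c idem c = 1.
Proof. by rewrite -rmorph_sum sum_idempotent_poly // rmorph1. Qed.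

(** The subalgebra generated by x is spanned by the idempotents idem d, and x
    acts on it diagonally with distinct eigenvalues, so e c = s *: idem c for
    some s; as both are nonzero idempotents, s = 1. *)
Lemma eigen_idempotentE c : e c = idem c.
Proof.
have [[e_in ee e_neq0 _] xe] := eE c.
pose V := <<[seq idem d | d <- enum 'F_p]>>%VS.
have idemV d : idem d \in V by rewrite memv_span ?map_f ?mem_enum.
have /subvP/(_ _ e_in) eV : (<<1; x>> <= V)%VS.
  have V1 : (1 <= V)%VS.
    by rewrite -memvE -sum_idem; apply: memv_suml => d _.
  apply: agenv_sub_modl => //; apply/prodvP => u v.
  case/memv_addP => _ /vlineP[s ->] [_ /vlineP[t ->] ->] vV.
  rewrite mulrDl -!scalerAl mul1r memvD ?memvZ //.
  move: v vV; apply: span_ind => [b u1 u2 u1V u2V||_ /mapP[d _ ->]].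
  - by rewrite mulrDr -scalerAr memvD ?memvZ.
  - by rewrite mulr0 mem0v.
  - by rewrite x_idem memvZ.
have idem_e : idem c * e c = e c.
  have := @eigenvector_idem A^o (e c) c c; rewrite eqxx; apply.
  by rewrite /GRing.scale /= mulr_algl.
have [s es] : exists s, e c = s *: idem c.
  rewrite -idem_e; move: (e c) eV.
  apply: span_ind => [b u v [s us] [t vt]||_ /mapP[d _ ->]].
  - by exists (b * s + t); rewrite mulrDr -scalerAr us vt scalerDl scalerA.
  - by exists 0; rewrite mulr0 scale0r.
  - by exists (c == d)%:R; rewrite idemM scaler_nat; case: eqP => [->|].
have s_neq0 : s != 0 by apply: contraNneq e_neq0 => s0; rewrite es s0 scale0r.
by apply: (scalerI s_neq0); rewrite -{1}idem_e scalerAl -es ee.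
Qed.

Lemma sum_eigen_idempotent : \sum_c e c = 1.
Proof.
by rewrite -sum_idem; apply: eq_bigr => c _; rewrite eigen_idempotentE.
Qed.

Lemma eigen_idempotentM c d : e c * e d = e d *+ (c == d).
Proof. by rewrite !eigen_idempotentE idemM. Qed.

Lemma x_eigen_idempotent c : x * e c = Fp_in k c *: e c.
Proof. by have [] := eE c. Qed.

Lemma eigen_idempotent_act (M : lmodType A) (v : M) c d :
  x *: v = (Fp_in k c)%:A *: v -> e d *: v = v *+ (c == d).
Proof. by rewrite eigen_idempotentE; apply: eigenvector_idem. Qed.

Let gx : g * x = x * g + g + g ^+ 2.
Proof.
have a_unit : a \is a GRing.unit.
  by apply/unitrP; exists (a ^+ n); rewrite -exprS -exprSr nS aN.
have ax : a * x = (x + g) * a by rewrite gE -conj_x divrK.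
have aE : a = g + 1 by rewrite gE subrK.
rewrite [in LHS]gE mulrBl mul1r ax [in X in _ * X]aE mulrDr mulr1 mulrDl -expr2.
by rewrite [x + g]addrC addrA addrK addrAC.
Qed.

Let x_gX j : x * g ^+ j = g ^+ j * x - (g ^+ j + g ^+ j.+1) *+ j.
Proof.
have xg : x * g = g * x - g - g ^+ 2 by rewrite gx [RHS]addrAC !addrK.
elim: j => [|j IHj]; first by rewrite expr0 mulr1 mul1r subr0.
have gxg : g ^+ j * x * g = g ^+ j.+1 * x - g ^+ j.+1 - g ^+ j.+2.
  by rewrite -mulrA xg !mulrBr mulrA -exprSr -exprD addn2.
rewrite [in LHS]exprSr mulrA IHj mulrBl mulrnAl mulrDl -!exprSr gxg.
by rewrite mulrS !opprD !addrA.
Qed.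

Let gN0 : g ^+ n.+1 = 0.
Proof.
suff gX j : g ^+ (p ^ j)%N = a ^+ (p ^ j)%N - 1 by rewrite nS gX aN subrr.
elim: j => [|j IHj]; first by rewrite gE.
rewrite expnSr !exprM IHj -pFrobenius_autE.
by rewrite pFrobenius_autB_comm ?pFrobenius_autE ?expr1n //; apply: commr1.
Qed.

(** Up to higher powers of g, multiplication by g lowers the eigenvalue of x
    by 1; so the last nonzero vector among the g^j v is again an eigenvector. *)
Lemma x_gX_eigenvector (M : lmodType A) (v : M) (c : 'F_p) j :
  x *: v = (Fp_in k c)%:A *: v ->
  x *: (g ^+ j *: v)
    = (Fp_in k (c - j%:R))%:A *: (g ^+ j *: v) - (g ^+ j.+1 *: v) *+ j.
Proof.
rewrite Fp_inD // Fp_inN // Fp_in_nat //; move: (Fp_in k c) => s xv.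
have jA : (j%:R : k)%:A = j%:R :> A by rewrite scaler_nat.
rewrite scalerBl jA [in RHS]scalerBl scaler_nat -addrA -opprD -mulrnDl.
rewrite -scalerDl scalerA x_gX scalerBl -scalerMnl.
by rewrite -scalerA xv !scalerA mulr_algl mulr_algr.
Qed.

(** On the given basis: a^j x^i is the sum over c of c^i (1 + g)^j e_c. *)
Lemma horner_decomposition b :
  exists P : 'F_p -> {poly k}, b = \sum_c horner_alg g (P c) * e c.
Proof.
have := memvf b; rewrite -(span_basis a_x_basis).
move: b; apply: span_ind => [s u v [P ->] [Q ->]||_ /allpairsP[[j i] [_ _ ->]]].
- exists (fun c => s *: P c + Q c); rewrite scaler_sumr -big_split /=.
  by apply: eq_bigr => c _; rewrite linearP /= mulr_algl mulrDl -scalerAl.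
- by exists (fun=> 0); rewrite big1 // => c _; rewrite rmorph0 mul0r.
exists (fun c => Fp_in k c ^+ i *: (1 + 'X) ^+ j) => /=.
rewrite -[LHS]mulr1 -sum_eigen_idempotent mulr_sumr.
apply: eq_bigr => c _; rewrite linearZ /= mulr_algl rmorphXn rmorphD rmorph1.
rewrite /= horner_algX.
rewrite gE addrC subrK -mulrA -scalerAl; move: (a ^+ j) => b.
elim: i => [|i IHi]; first by rewrite expr0 mul1r expr0 scale1r.
rewrite [x ^+ _]exprSr -mulrA x_eigen_idempotent -!scalerAr IHi.
by rewrite scalerA exprS.
Qed.

Lemma mul_eigen_idempotent b c :
  exists P, b * e c = horner_alg g P * e c.
Proof.
have [P ->] := horner_decomposition b; exists (P c).
rewrite mulr_suml (bigD1 c) //= big1 ?addr0 => [|d neq_dc].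
  by rewrite -mulrA eigen_idempotentM eqxx.
by rewrite -mulrA eigen_idempotentM (negPf neq_dc) mulr0.
Qed.

(** These elements span A by the decomposition above, and there are as many of
    them as in the given basis. *)
Lemma gX_eigen_idempotent_basis :
  basis_of fullv [seq g ^+ j * e c | j <- iota 0 n.+1, c <- enum 'F_p].
Proof.
rewrite basisEdim size_allpairs size_iota -cardE card_Fp // nS.
have := size_basis (X := in_tuple _) a_x_basis.
rewrite size_allpairs !size_iota => ->; rewrite leqnn andbT.
apply/subvP=> b _; have [P ->] := horner_decomposition b.
apply: memv_suml => c _; rewrite -[P c]coefK poly_def linear_sum mulr_suml.
apply: memv_suml => j _; rewrite linearZ /= mulr_algl rmorphXn /= horner_algX.
rewrite -scalerAl memvZ //.
have [le_nj|lt_jn] := leqP n.+1 j.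
  by rewrite -(subnKC le_nj) exprD gN0 !mul0r mem0v.
apply: memv_span; apply/allpairsP; exists (j : nat, c).
by rewrite mem_iota mem_enum -nS.
Qed.

(** * The socle of A e_c *)

Let soc c := g ^+ n * e c.

Lemma soc_neq0 c : soc c != 0.
Proof.
apply: (basis_not0 gX_eigen_idempotent_basis); apply/allpairsP; exists (n, c).
by rewrite mem_iota mem_enum leqnn.
Qed.

Let xXn : x * g ^+ n = g ^+ n * x + g ^+ n.
Proof.
have char_n : n.+1%:R = 0 :> A.
  rewrite nS; apply/eqP; rewrite -(dvdn_pcharf charAp).
  by rewrite -(prednK r_gt0) expnS dvdn_mulr.
rewrite x_gX gN0 addr0; congr (_ + _); apply/eqP.
by rewrite eq_sym -addr_eq0 -mulrS -mulr_natl char_n mul0r.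
Qed.

Lemma x_soc c : x * soc c = Fp_in k (c + 1) *: soc c.
Proof.
rewrite /soc mulrA xXn mulrDl -mulrA x_eigen_idempotent -scalerAr.
by rewrite Fp_inD // Fp_in1 // scalerDl scale1r.
Qed.

Lemma mul_idem_soc c d : e d * soc c = soc c *+ (c + 1 == d).
Proof.
by apply: (@eigen_idempotent_act A^o); rewrite /GRing.scale /= x_soc mulr_algl.
Qed.

(** Since g is nilpotent, a polynomial with P(0) <> 0 is coprime to a power of
    the variable that vanishes at g. *)
Let horner_g_inv (P : {poly k}) :
  P.[0] != 0 -> exists W, horner_alg g W * horner_alg g P = 1.
Proof.
move=> P0; have : coprimep P ('X ^+ n.+1).
  by rewrite coprimep_expr // -['X]subr0 coprimep_XsubC rootE.
case/Bezout_eq1_coprimepP=> -[U V] /= UV; exists U.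
have HX : horner_alg g ('X ^+ n.+1) = 0 by rewrite rmorphXn /= horner_algX.
rewrite -(rmorph1 (horner_alg g)) -UV rmorphD !rmorphM /= HX.
by rewrite mulr0 addr0.
Qed.

(** Here b e_c = Q(g) g^m e_c with Q(g) invertible, where m is the multiplicity
    of 0 as a root; multiply by g^(n-m) Q(g)^-1. *)
Lemma soc_essential b c : b * e c != 0 -> exists w, w * (b * e c) = soc c.
Proof.
have [P ->] := mul_eigen_idempotent b c => P_neq0.
have [m [Q Q0 PE]] := multiplicity_XsubC P 0.
have P_n0 : P != 0 by apply: contraNneq P_neq0 => ->; rewrite rmorph0 mul0r.
have {Q0} [W WQ] : exists W, horner_alg g W * horner_alg g Q = 1.
  by apply: horner_g_inv; move: Q0; rewrite P_n0 rootE.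
have HP : horner_alg g P = horner_alg g Q * g ^+ m.
  by rewrite PE subr0 rmorphM rmorphXn /= horner_algX.
have le_mn : (m <= n)%N.
  rewrite -ltnS ltnNge; apply: contra P_neq0 => le_nm.
  by rewrite HP -(subnKC le_nm) exprD gN0 mul0r mulr0 mul0r.
exists (g ^+ (n - m) * horner_alg g W); rewrite HP -!mulrA.
by rewrite (mulrA (horner_alg g W)) WQ mul1r mulrA -exprD subnK.
Qed.

(** If b e_c = P(g) e_c is not killed by g^n, then P(0) <> 0, so P(g) is
    invertible. *)
Lemma eigen_ideal_generator b c :
  g ^+ n * (b * e c) != 0 -> exists w, w * (b * e c) = e c.
Proof.
have [P ->] := mul_eigen_idempotent b c => gP_neq0.
have [W WP] : exists W, horner_alg g W * horner_alg g P = 1.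
  apply: horner_g_inv; apply: contra gP_neq0 => /factor_theorem[Q ->].
  by rewrite subr0 mulrC rmorphM /= horner_algX !mulrA -exprSr gN0 !mul0r.
by exists (horner_alg g W); rewrite mulrA WP mul1r.
Qed.

(** On each A e_c, a model of k[g]/(g^(n+1)), the kernel of g^n is the image of
    g. *)
Lemma gXn_eq0 b : g ^+ n * b = 0 -> exists b', b = g * b'.
Proof.
move=> gb0; have be c : exists b', b * e c = g * b'.
  have [P PE] := mul_eigen_idempotent b c; rewrite PE.
  have [/factor_theorem[Q ->]|P0] := boolP (root P 0).
    exists (horner_alg g Q * e c).
    by rewrite subr0 mulrC rmorphM /= horner_algX mulrA.
  have [W WP] := horner_g_inv P0.
  case/eqP: (soc_neq0 c); rewrite /soc -[e c]mul1r -WP.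
  have -> : g ^+ n = horner_alg g 'X^n by rewrite rmorphXn /= horner_algX.
  rewrite !mulrA -rmorphM mulrC rmorphM /= rmorphXn /= horner_algX.
  by rewrite -!mulrA -PE !mulrA -[_ * _ * b]mulrA gb0 mulr0 mul0r.
have [f fE] := choice be; exists (\sum_c f c).
rewrite mulr_sumr -[LHS]mulr1 -sum_eigen_idempotent mulr_sumr.
by apply: eq_bigr => c _; rewrite fE.
Qed.

(** * Central idempotents *)

(** One of z e_c and (1 - z) e_c is 0, as otherwise both would generate the
    socle of A e_c, on which z would be both 1 and 0. The socle vector g^n e_c
    lies in e_(c+1) A e_c, and this links neighbouring indices. *)
Lemma central_idempotent_trivial z :
  z * z = z -> (forall b, z * b = b * z) -> z = 0 \/ z = 1.
Proof.
move=> zz zC.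
have ze c : z * e c = 0 \/ z * e c = e c.
  have [->|ze_neq0] := eqVneq (z * e c) 0; first by left.
  right; apply/eqP; rewrite eq_sym -subr_eq0; apply: contraT => ze'_neq0.
  have [w ws] := soc_essential ze_neq0.
  have [|w' ws'] := @soc_essential (1 - z) c; first by rewrite mulrBl mul1r.
  have zs1 : z * soc c = soc c by rewrite -ws mulrA zC -mulrA (mulrA z) zz.
  case/eqP: (soc_neq0 c); rewrite -zs1 -ws' mulrA zC -mulrA (mulrA z).
  by rewrite mulrBr mulr1 zz subrr mul0r mulr0.
have ze_succ c : z * e c = 0 <-> z * e (c + 1) = 0.
  have es : e (c + 1) * soc c = soc c by rewrite mul_idem_soc eqxx.
  have zs : z * soc c = g ^+ n * (z * e c) by rewrite mulrA zC -mulrA zC mulrA.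
  have zes : z * soc c = z * e (c + 1) * soc c by rewrite -mulrA es.
  split=> ze0.
    have [//|zeS] := ze (c + 1); case/eqP: (soc_neq0 c).
    by rewrite -es -zeS -zes zs ze0 mulr0.
  have [//|zeE] := ze c; case/eqP: (soc_neq0 c).
  by rewrite /soc -zeE -zs zes ze0 mul0r.
have ze_nat j : z * e 0 = 0 <-> z * e j%:R = 0.
  elim: j => [|j IHj] //; rewrite -natr1.
  exact: iff_trans IHj (ze_succ _).
have ze_all c : z * e 0 = 0 <-> z * e c = 0.
  by rewrite -[c]natr_Zp; apply: ze_nat.
have zE : z = \sum_c z * e c by rewrite -mulr_sumr sum_eigen_idempotent mulr1.
have [z0|z0] := ze 0; [left | right]; rewrite zE.
  by rewrite big1 // => c _; apply/ze_all.
rewrite -sum_eigen_idempotent; apply: eq_bigr => c _.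
have [/ze_all z00|//] := ze c.
by have := soc_neq0 0; rewrite /soc -z0 z00 mulr0 eqxx.
Qed.

(** A product decomposition of A gives the central idempotent (1, 0). *)
Lemma third_type_indecomposable : indecomposable_algebra A.
Proof.
case=> B [C [f [f' fK f'K]]]; pose z := f' (1, 0).
have fz : f z = (1, 0) by rewrite f'K.
have [||z0|z1] := @central_idempotent_trivial z.
- apply: (can_inj fK); rewrite rmorphM /= fz; congr (_, _).
    exact: mulr1.
  exact: mulr0.
- move=> b; apply: (can_inj fK); rewrite !rmorphM /= fz.
  case: (f b) => u v; congr (_, _); first by rewrite /= mul1r mulr1.
  by rewrite /= mul0r mulr0.
- have /esym/eqP := congr1 fst (etrans (esym fz) (congr1 f z0)).
  by rewrite rmorph0 /= eq_sym oner_eq0.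
- have /esym/eqP := congr1 snd (etrans (esym fz) (congr1 f z1)).
  by rewrite rmorph1 /= oner_eq0.
Qed.

(** * Simple modules *)

(** The scalar is the same for all such vectors of all modules, which makes two
    simple modules with the same eigenvalue of x isomorphic. *)
Lemma eigenvector_scalar c b : exists s : k, forall (M : lmodType A) (v : M),
  x *: v = (Fp_in k c)%:A *: v -> g *: v = 0 -> b *: v = s%:A *: v.
Proof.
have [P ->] := horner_decomposition b; exists (P c).[0] => M v xv gv.
rewrite scaler_suml (bigD1 c) //= big1 ?addr0 => [|d neq_dc].
  rewrite -scalerA (eigen_idempotent_act _ xv) eqxx mulr1n.
  by apply: horner_alg_eigen; rewrite gv scale0r scale0r.
by rewrite -scalerA (eigen_idempotent_act _ xv) eq_sym (negPf neq_dc) scaler0.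
Qed.

Lemma exists_eigenvector (M : lmodType A) (m : M) : m != 0 ->
  exists (b : A) (c : 'F_p), [/\ b *: m != 0,
    x *: (b *: m) = (Fp_in k c)%:A *: (b *: m) & g *: (b *: m) = 0].
Proof.
move=> m_neq0.
have [c ec_neq0] : exists c, e c *: m != 0.
  apply/existsP; apply: contraNT m_neq0 => /existsPn em.
  rewrite -[m]scale1r -sum_eigen_idempotent scaler_suml big1 // => c _.
  by apply/eqP; have := em c; rewrite negbK.
have xec : x *: (e c *: m) = (Fp_in k c)%:A *: (e c *: m).
  by rewrite !scalerA x_eigen_idempotent mulr_algl.
have ex_j : exists j, g ^+ j.+1 *: (e c *: m) == 0.
  by exists n; rewrite gN0 scale0r.
case: (ex_minnP ex_j) => j /eqP gj0 j_min.
have gj_neq0 : g ^+ j *: (e c *: m) != 0.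
  case: j gj0 j_min => [|j] _ j_min; first by rewrite expr0 scale1r.
  by apply/negP => /j_min; rewrite ltnn.
exists (g ^+ j * e c), (c - j%:R); rewrite -scalerA; split=> //.
  by rewrite (x_gX_eigenvector j xec) gj0 mul0rn subr0.
by rewrite scalerA -exprS.
Qed.

Lemma simple_eigenvector (M : lmodType A) : simple_module M ->
  exists (v : M) (c : 'F_p), [/\ v != 0, x *: v = (Fp_in k c)%:A *: v,
    g *: v = 0 & forall m, exists b, m = b *: v].
Proof.
move=> M_simple; have [[m m_neq0] _] := M_simple.
have [b [c [v_neq0 xv gv]]] := exists_eigenvector m_neq0.
by exists (b *: m), c; split=> //; apply: simple_module_cyclic.
Qed.

Lemma simple_one_dimensional (M : lmodType A) :
  simple_module M -> one_dimensional M.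
Proof.
move=> /simple_eigenvector[v [c [v_neq0 xv gv v_gen]]]; exists v => // m.
have [b ->] := v_gen m; have [s sE] := eigenvector_scalar c b.
by exists s; apply: sE.
Qed.

(** The line spanned by the socle vector of A e_c, where x acts by c + 1. *)
Let soc_module c : lmodType A := left_ideal (soc c).
Let soc_vec c : soc_module c := left_mult (soc c) 1.

Let x_soc_vec c : x *: soc_vec c = (Fp_in k (c + 1))%:A *: soc_vec c.
Proof.
apply: val_inj; rewrite -[LHS]/(x * (1 * soc c)) mul1r x_soc.
by rewrite -[RHS]/(_%:A * (1 * soc c)) mul1r mulr_algl.
Qed.

Let g_soc_vec c : g *: soc_vec c = 0.
Proof.
apply: val_inj; rewrite -[LHS]/(g * (1 * soc c)) mul1r /soc mulrA -exprS.
by rewrite gN0 mul0r.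
Qed.

Let soc_vec_neq0 c : soc_vec c != 0.
Proof.
apply: contra (soc_neq0 c) => /eqP/(congr1 val) /= s0.
by rewrite -[soc c]mul1r; apply/eqP.
Qed.

Let soc_moduleP c (t : soc_module c) : exists s : k, t = s%:A *: soc_vec c.
Proof.
have [b ->] := left_idealP t; rewrite left_multE.
by have [s sE] := eigenvector_scalar (c + 1) b; exists s; apply: sE.
Qed.

Lemma soc_module_act c (t : soc_module c) :
  x *: t = (Fp_in k (c + 1))%:A *: t /\ a *: t = t.
Proof.
have [s ->] := soc_moduleP t.
have comm b : b *: (s%:A *: soc_vec c) = s%:A *: (b *: soc_vec c).
  by rewrite !scalerA mulr_algl mulr_algr.
have aE : a = g + 1 by rewrite gE subrK.
by rewrite !comm x_soc_vec aE scalerDl g_soc_vec add0r scale1r.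
Qed.

Lemma scaleA_eq0 (M : lmodType A) (s : k) (v : M) :
  v != 0 -> s%:A *: v = 0 -> s = 0.
Proof.
move=> v_neq0 sv0; apply: contraNeq v_neq0 => s_neq0.
have : (s^-1 *: (1 : A)) *: (s%:A *: v) = 0 by rewrite sv0 scaler0.
by rewrite scalerA mulr_algl scalerA mulVf // !scale1r => ->.
Qed.

Lemma soc_module_simple c : simple_module (soc_module c).
Proof.
split=> [|N [N0 NL]]; first by exists (soc_vec c).
have NZ b u : u \in N -> b *: u \in N.
  by move=> uN; rewrite -[_ *: _]addr0; apply: NL.
have [sN|sN] := boolP (soc_vec c \in N); [right | left] => u.
  by have [s ->] := soc_moduleP u; apply: NZ.
have [s ->] := soc_moduleP u => suN.
have [->|s_neq0] := eqVneq s 0; first by rewrite scale0r scale0r.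
case/negP: sN; rewrite -[soc_vec c]scale1r -(scale1r 1) -(mulVf s_neq0).
by rewrite -scalerA -mulr_algl -scalerA; apply: NZ.
Qed.

Lemma soc_module_iso c d : module_iso (soc_module c) (soc_module d) -> c = d.
Proof.
case=> f f_bij; have fs_neq0 : f (soc_vec c) != 0.
  by rewrite raddf_eq0 ?soc_vec_neq0 //; apply: bij_inj.
have /eqP := congr1 f (x_soc_vec c).
rewrite !linearZ /= (soc_module_act _).1 eq_sym -subr_eq0 -scalerBl -scalerBl.
move=> /eqP/(scaleA_eq0 fs_neq0)/eqP; rewrite subr_eq0.
by rewrite (inj_eq (Fp_in_inj charkp)) => /eqP/addIr.
Qed.

Lemma simple_iso_soc (M : lmodType A) :
  simple_module M -> exists c, module_iso M (soc_module c).
Proof.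
move=> /simple_eigenvector[v [c [v_neq0 xv gv v_gen]]]; exists (c - 1).
have act b : exists s : k, b *: v = s%:A *: v
    /\ b *: soc_vec (c - 1) = s%:A *: soc_vec (c - 1).
  have [s sE] := eigenvector_scalar c b; exists s; split; apply: sE => //.
  by rewrite x_soc_vec subrK.
apply: module_iso_sym.
have [|f fE] := @left_ideal_hom _ _ (soc (c - 1)) M v.
  move=> b bs0; have [s [-> bs]] := act b.
  rewrite (@scaleA_eq0 _ s (soc_vec (c - 1))) ?scale0r ?scale0r // -bs.
  by apply: val_inj; rewrite -[LHS]/(b * (1 * _)) mul1r.
apply: (@module_iso_of_surjection _ _ _ f) => [u|m].
  have [b ->] := left_idealP u; rewrite fE left_multE.
  have [s [-> ->]] := act b.
  by move=> /(scaleA_eq0 v_neq0) ->; rewrite scale0r scale0r.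
by have [b ->] := v_gen m; exists (left_mult _ b).
Qed.

(** * Projective indecomposable modules *)

Lemma eigen_ideal_projective c :
  projective_module (left_ideal (e c) : lmodType A).
Proof. by apply: left_ideal_projective; rewrite eigen_idempotentM eqxx. Qed.

Lemma eigen_ideal_neq0 c : exists u : left_ideal (e c), u != 0.
Proof.
exists (left_mult (e c) 1).
apply: contraNneq (soc_neq0 c) => /(congr1 val) /=; rewrite mul1r => e0.
by rewrite /soc e0 mulr0.
Qed.

(** Every nonzero submodule contains the socle vector t. *)
Lemma eigen_ideal_indecomposable c :
  indecomposable_module (left_ideal (e c) : lmodType A).
Proof.
split=> [|N1 N2 N1sub N2sub N12 _]; first exact: eigen_ideal_neq0.
pose t := left_mult (e c) (g ^+ n).
have t_neq0 : t != 0.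
  by apply: contraNneq (soc_neq0 c) => /(congr1 val) /= t0; apply/eqP.
have tN (N : {pred (left_ideal (e c) : lmodType A)}) u :
    submod_closed N -> u \in N -> u != 0 -> t \in N.
  move=> [N0 NL] uN u_neq0; have [b uE] := left_idealP u.
  have [|w wE] := @soc_essential b c.
    apply: contra u_neq0 => /eqP be0; apply/eqP; rewrite uE.
    exact: val_inj.
  have -> : t = w *: u by apply: val_inj; rewrite uE -[RHS]/(w * (b * e c)) wE.
  by rewrite -[_ *: _]addr0; apply: NL.
have [tN1|tN1] := boolP (t \in N1); [right | left] => u uN; apply/eqP.
  apply: contraT => u_neq0; case/eqP: t_neq0.
  by apply: N12 => //; apply: tN u_neq0.
by apply: contraNT tN1 => u_neq0; apply: tN u_neq0.
Qed.

(** The eigenvalue of x on the socle is an isomorphism invariant: the image of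
    the socle vector of A e_c is an eigenvector for c + 1, and by essentiality
    a multiple of it is the socle vector of A e_d. *)
Lemma eigen_ideal_iso c d :
  module_iso (left_ideal (e c) : lmodType A) (left_ideal (e d) : lmodType A) ->
  c = d.
Proof.
case=> f f_bij; pose t := left_mult (e c) (g ^+ n).
have t_neq0 : t != 0.
  by apply: contraNneq (soc_neq0 c) => /(congr1 val) /= t0; apply/eqP.
have xt : x *: t = (Fp_in k (c + 1))%:A *: t.
  apply: val_inj; rewrite -[LHS]/(x * soc c) -[RHS]/(_%:A * soc c).
  by rewrite x_soc mulr_algl.
have gt : g *: t = 0.
  by apply: val_inj; rewrite -[LHS]/(g * (g ^+ n * e c)) mulrA -exprS gN0 mul0r.
have ft_neq0 : f t != 0 by rewrite raddf_eq0 //; apply: bij_inj.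
have [b fE] := left_idealP (f t).
have [|w wE] := @soc_essential b d.
  apply: contra ft_neq0 => /eqP be0; apply/eqP; rewrite fE.
  exact: val_inj.
have [s sE] := eigenvector_scalar (c + 1) w.
have xz : x * (b * e d) = Fp_in k (c + 1) *: (b * e d).
  have /(congr1 f) := xt; rewrite !linearZ /= fE => /(congr1 val) /=.
  by rewrite /GRing.scale /= mulr_algl.
have socE : soc d = s *: (b * e d).
  rewrite -wE; have /(congr1 f) := sE _ t xt gt; rewrite !linearZ /= fE.
  by move=> /(congr1 val) /=; rewrite /GRing.scale /= mulr_algl.
have : (Fp_in k (c + 1) - Fp_in k (d + 1)) *: soc d == 0.
  by rewrite scalerBl -x_soc socE -scalerAr xz scalerA mulrC -scalerA subrr.
rewrite scaler_eq0 (negPf (soc_neq0 d)) orbF subr_eq0.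
by rewrite (inj_eq (Fp_in_inj charkp)) => /eqP/addIr.
Qed.

(** A linear form phi with g^n phi(m) <> 0 exists by the dual basis and the
    nilpotency of g. It provides a surjection y |-> phi(y) e_c of P onto A e_c,
    whose section sends e_c to e_c w m, where w phi(m) e_c = e_c. *)
Lemma projective_indecomposable_iso (P : lmodType A) :
  projective_module P -> indecomposable_module P ->
  exists c, module_iso P (left_ideal (e c) : lmodType A).
Proof.
move=> P_proj P_indec.
have [phi [m phi_m]] : exists (phi : {linear P -> A^o}) (m : P),
    g ^+ n * (phi m : A) != 0.
  apply: contrapT => no_phi; have [[m m_neq0] _] := P_indec.
  (* then every phi(y) is a multiple of g, and the dual basis gives P = g P *)
  have gP (y : P) : exists z, y = g *: z.
    have [I [s [phi [w yE]]]] := projective_dual_basis P_proj y.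
    have phi_g i : exists b, (phi i y : A) = g * b.
      apply: gXn_eq0; apply: contrapT => /eqP phi_neq0.
      by apply: no_phi; exists (phi i), y.
    have [f fE] := choice phi_g; exists (\sum_(i <- s) f i *: w i).
    rewrite scaler_sumr {1}yE; apply: eq_bigr => i _.
    by rewrite fE scalerA.
  have gXP j (y : P) : exists z, y = g ^+ j *: z.
    elim: j y => [|j IHj] y; first by exists y; rewrite expr0 scale1r.
    have [z ->] := IHj y; have [z' ->] := gP z.
    by exists z'; rewrite scalerA -exprSr.
  by case/eqP: m_neq0; have [z ->] := gXP n.+1 m; rewrite gN0 scale0r.
have [c phi_mc] : exists c, g ^+ n * ((phi m : A) * e c) != 0.
  apply/existsP; apply: contraNT phi_m => /existsPn em.
  rewrite -[phi m : A]mulr1 -sum_eigen_idempotent !mulr_sumr big1 // => c _.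
  by apply/eqP; have := em c; rewrite negbK.
have [w wE] := eigen_ideal_generator phi_mc; exists c.
have ideal_lin : linear (fun y => left_mult (e c) (phi y)).
  move=> b u v; apply: val_inj => /=; rewrite linearP.
  by rewrite -[b *: _]/(b * _) mulrDl -mulrA.
have [f fE] := linear_of_fun ideal_lin.
have [|s sE] := @left_ideal_hom _ _ (e c) P (e c *: (w *: m)).
  by move=> b be0; rewrite scalerA be0 scale0r.
apply: (@indecomposable_retract _ _ _ f s P_indec).
  exact: eigen_ideal_neq0.
move=> u; have [b ->] := left_idealP u; rewrite sE fE; apply: val_inj => /=.
rewrite !linearZ /= -[_ *: _]/(b * (e c * (w * (phi m : A)))) -!mulrA wE.
by rewrite eigen_idempotentM eqxx.
Qed.

End Structure.

Theorem lemma4p19 (k : fieldType) (p : nat) (charkp : p \in [pchar k])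
    (r : nat) (r_gt0 : (0 < r)%N) (A : falgType k) (a x : A)
    (Delta : {linear A -> tensor A A}) (eps : {lrmorphism A -> k^o})
    (S : {linear A -> A})
    (HA : third_type_cyclic p r a x Delta eps S)
    (e : 'F_p -> A) (He : forall c : 'F_p, eigen_idempotent x c (e c)) :
  [/\ indecomposable_algebra A,
      forall M : lmodType A, simple_module M -> one_dimensional M,
      exists T : 'F_p -> lmodType A,
        [/\ forall c, simple_module (T c),
            forall (c : 'F_p) (t : T c),
              x *: t = (Fp_in k c)%:A *: t /\ a *: t = t,
            forall c d, module_iso (T c) (T d) -> c = d
          & forall M : lmodType A, simple_module M ->
              exists c, module_iso M (T c)]
    & [/\ forall c, projective_module (left_ideal (e c) : lmodType A)
                    /\ indecomposable_module (left_ideal (e c) : lmodType A),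
          forall c d, module_iso (left_ideal (e c) : lmodType A)
                                 (left_ideal (e d) : lmodType A) -> c = d
        & forall P : lmodType A, projective_module P ->
            indecomposable_module P ->
            exists c, module_iso P (left_ideal (e c) : lmodType A)]].
Proof.
have [basis_A aN conj_x xp _ _ _ _ _ _ _] := HA.
have gE : a - 1 = a - 1 by [].
split.
- exact (third_type_indecomposable charkp r_gt0 basis_A aN conj_x xp He gE).
- exact (simple_one_dimensional charkp basis_A aN conj_x xp He gE).
(* x acts on the socle of A e_d by d + 1, hence the shift of the index *)
- exists (fun c => left_ideal ((a - 1) ^+ (p ^ r).-1 * e (c - 1))); split.
  + move=> c.
    exact (soc_module_simple charkp r_gt0 basis_A aN conj_x xp He gE (c - 1)).
  + move=> c t; rewrite -[in Fp_in k c](subrK 1 c).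
    exact (soc_module_act charkp r_gt0 basis_A aN conj_x xp He gE t).
  + move=> c d /(soc_module_iso charkp r_gt0 basis_A aN conj_x xp He gE).
    exact: addIr.
  + move=> M.
    move=> /(simple_iso_soc charkp r_gt0 basis_A aN conj_x xp He gE)[c M_iso].
    by exists (c + 1); rewrite addrK.
- split=> [c|c d|P].
  + split; first exact: (eigen_ideal_projective charkp xp He).
    exact (eigen_ideal_indecomposable charkp basis_A aN xp He gE c).
  + move=> cd_iso.
    exact (eigen_ideal_iso charkp r_gt0 basis_A aN conj_x xp He gE cd_iso).
  + move=> P_proj P_indec.
    exact (projective_indecomposable_iso charkp basis_A aN xp He gE
             P_proj P_indec).
Qed.
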